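(* Let $(\Omega,\mu)$ be a measure space and let $1<p<\infty$. Let $\mathcal{M},\mathcal{N}\subseteq \mathcal{L}^p(\Omega,\mu)$ be subsets and let $A:\mathcal{M}\to\mathcal{L}^p(\Omega,\mu)$, $B:\mathcal{N}\to\mathcal{L}^p(\Omega,\mu)$ be (arbitrary) maps. Let $f\in\mathcal{M}\cap\mathcal{N}$ and $a,b\in\mathbb{C}$. Then for every $\phi\in(\mathcal{L}^p(\Omega,\mu))^*$ satisfying $\|\phi\|\le 1$ and $\phi(f)=0$, the following hold. (i) If $2\le p<\infty$, then $$\Delta_f(A,a)^p+\Delta_f(B,b)^p\ \ge\ \frac{1}{2^{p-1}}\left(|\phi((A+B)f)|^p+|\phi((A-B)f)|^p\right).$$ (ii) If $1<p\le 2$, then $$\Delta_f(A,a)^p+\Delta_f(B,b)^p\ \ge\ \frac{1}{2}\left(|\phi((A+B)f)|^p+|\phi((A-B)f)|^p\right).$$ (iii) If $2\le p<\infty$ and $q$ is the conjugate index of $p$, then $$\Delta_f(A,a)^q+\Delta_f(B,b)^q\ \ge\ \left(\frac{1}{2}\left(|\phi((A+B)f)|^p+|\phi((A-B)f)|^p\right)\right)^{\frac{1}{p-1}}.$$ (iv) If $1<p\le 2$ and $q$ is the conjugate index of $p$, then $$\Delta_f(A,a)^p+\Delta_f(B,b)^p\ \ge\ \left(\frac{1}{2}\left(|\phi((A+B)f)|^q+|\phi((A-B)f)|^q\right)\right)^{\frac{1}{q-1}}.$$ (v) If $1<p<\infty$, $q$ is the conjugate index of $p$, $1<r\le\min\{p,q\}$,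 and $s$ is the conjugate index of $r$, then $$\Delta_f(A,a)^r+\Delta_f(B,b)^r\ \ge\ \left(\frac{1}{2}\left(|\phi((A+B)f)|^s+|\phi((A-B)f)|^s\right)\right)^{\frac{1}{s-1}},$$ $$\Delta_f(A,a)^s+\Delta_f(B,b)^s\ \ge\ \frac{1}{2^{s-1}}\left(|\phi((A+B)f)|^s+|\phi((A-B)f)|^s\right),$$ $$\Delta_f(A,a)^r+\Delta_f(B,b)^r\ \ge\ \frac{1}{2}\left(|\phi((A+B)f)|^r+|\phi((A-B)f)|^r\right).$$
   Context: $\mathcal{L}^p(\Omega,\mu)$ is the usual complex Lebesgue space with norm $\|\cdot\|_p$, and $(\mathcal{L}^p(\Omega,\mu))^*$ is its space of bounded linear functionals with the operator norm $\|\phi\|$. The maps $A,B$ need not be linear, Lipschitz or continuous. For a map $A:\mathcal{M}\to\mathcal{L}^p(\Omega,\mu)$ defined on a subset $\mathcal{M}\subseteq\mathcal{L}^p(\Omega,\mu)$, $f\in\mathcal{M}$ and $a\in\mathbb{C}$, the uncertainty of $A$ at $f$ relative to $a$ is $\Delta_f(A,a):=\|Af-af\|_p$ (similarly for $B$ on $\mathcal{N}$). For $f\in\mathcal{M}\cap\mathcal{N}$, $(A+B)f:=Af+Bf$ and $(A-B)f:=Af-Bf$. The conjugate index of $p\in(1,\infty)$ is the number $q\in(1,\infty)$ with $\frac1p+\frac1q=1$. *)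

(* Defs.v *)
(* Requires MathComp, MathComp-Analysis and real-closed (R[i] is the field of
   complex numbers over R : realType). *)
From HB Require Import structures.
From mathcomp Require Import all_boot all_order all_algebra.
From mathcomp Require Import ring_quotient complex.
From mathcomp Require Import all_classical all_reals all_analysis.
From mathcomp Require Import measurable_realfun.

Set Implicit Arguments.
Unset Strict Implicit.
Unset Printing Implicit Defensive.

Import Order.TTheory GRing.Theory Num.Theory.
Import numFieldNormedType.Exports.

Local Open Scope classical_set_scope.
Local Open Scope ring_scope.

(* The R-valued modulus; the norm `|z| of the numFieldType R[i] is its image
   under the embedding of R in R[i] (lemma normc_def). *)
Notation normc := ComplexField.Normc.normc.

Section complex_measurable.
Context d (T : measurableType d) (R : realType).

Definition cmeasurable (f : T -> R[i]) : Prop :=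
  measurable_fun [set: T] (fun x => complex.Re (f x)) /\
  measurable_fun [set: T] (fun x => complex.Im (f x)).

Lemma cmeasurable_normc (f : T -> R[i]) :
  cmeasurable f -> measurable_fun [set: T] (fun x => normc (f x)).
Proof.
move=> [mr mi].
have -> : (fun x => normc (f x)) =
    (fun x => Num.sqrt (complex.Re (f x) ^+ 2 + complex.Im (f x) ^+ 2)).
  by apply/funext => x; case: (f x).
apply: (measurableT_comp (continuous_measurable_fun (@sqrt_continuous R))).
by apply: measurable_funD; exact: measurable_funX.
Qed.

Lemma cmeasurable0 : cmeasurable (0 : T -> R[i]).
Proof. by split; exact: measurable_cst. Qed.

Lemma cmeasurableD (f g : T -> R[i]) :
  cmeasurable f -> cmeasurable g -> cmeasurable (f + g).
Proof.
move=> [fr fi] [gr gi]; split.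
- have -> : (fun x => complex.Re ((f + g) x)) =
      (fun x => complex.Re (f x)) \+ (fun x => complex.Re (g x)).
    by apply/funext => x; rewrite /= /GRing.add/=; case: (f x) (g x) => ? ? [].
  exact: measurable_funD.
- have -> : (fun x => complex.Im ((f + g) x)) =
      (fun x => complex.Im (f x)) \+ (fun x => complex.Im (g x)).
    by apply/funext => x; rewrite /= /GRing.add/=; case: (f x) (g x) => ? ? [].
  exact: measurable_funD.
Qed.

Lemma cmeasurableZ (a : R[i]) (f : T -> R[i]) :
  cmeasurable f -> cmeasurable (a *: f).
Proof.
move=> [fr fi]; case: a => a b; split.
- have -> : (fun x => complex.Re (((a +i* b)%C *: f) x)) =
      (cst a \* (fun x => complex.Re (f x))) \-
      (cst b \* (fun x => complex.Im (f x))).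
    by apply/funext => x; rewrite -[(_ *: f) x]/((a +i* b)%C * f x) /=; case: (f x).
  by apply: measurable_funB; exact: measurable_funM.
- have -> : (fun x => complex.Im (((a +i* b)%C *: f) x)) =
      (cst a \* (fun x => complex.Im (f x))) \+
      (cst b \* (fun x => complex.Re (f x))).
    by apply/funext => x; rewrite -[(_ *: f) x]/((a +i* b)%C * f x) /=; case: (f x).
  by apply: measurable_funD; exact: measurable_funM.
Qed.

End complex_measurable.


Section CLfun.
Context d (T : measurableType d) (R : realType).
Variables (mu : {measure set T -> \bar R}) (p : R) (p1 : 1 <= p).
Implicit Types f g : T -> R[i].

Definition CLfun_pred : {pred T -> R[i]} :=
  [pred f | `[< cmeasurable f /\ (fun x => normc (f x)) \in Lfun mu p%:E >]].

Lemma normc_ge0 (z : R[i]) : 0 <= normc z.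
Proof. by case: z => ? ?; exact: sqrtr_ge0. Qed.

Lemma le_Lnorm_EFin (g h : T -> R) :
  measurable_fun [set: T] g -> measurable_fun [set: T] h ->
  (forall x, `|g x| <= `|h x|) ->
  ('N[mu]_p%:E[EFin \o g] <= 'N[mu]_p%:E[EFin \o h])%E.
Proof.
move=> mg mh gh; have p0 : 0 < p by rewrite (lt_le_trans ltr01).
have mP (k : T -> R) : measurable_fun [set: T] k ->
    measurable_fun [set: T] (fun x => `|(EFin \o k) x| `^ p)%E.
  move=> mk; apply: (@measurableT_comp _ _ _ _ _ _ (fun x => x `^ p)%E).
    exact: measurable_poweR.
  by apply: measurableT_comp => //; exact/measurable_EFinP.
have iP (k : T -> R) : (\int[mu]_x `|(EFin \o k) x| `^ p)%E \in `[0%E, +oo%E].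
  by rewrite in_itv/= leey andbT; apply: integral_ge0 => x _; rewrite lee_fin powR_ge0.
rewrite unlock; apply: gt0_ler_poweR => //.
  by rewrite invr_ge0 ltW.
apply: ge0_le_integral => //; [|exact: mP|exact: mP|].
- by move=> x _; exact: poweR_ge0.
- by move=> x _ /=; rewrite lee_fin ge0_ler_powR ?nnegrE ?normr_ge0 ?(ltW p0).
Qed.

Lemma CLfun_dominated f (h : T -> R) : cmeasurable f -> h \in Lfun mu p%:E ->
  (forall x, normc (f x) <= h x) -> f \in CLfun_pred.
Proof.
move=> mf Lh fleh.
have mh : measurable_fun [set: T] h by exact/set_mem/(sub_Lfun_mfun Lh).
have fh : finite_norm mu p%:E h by exact/set_mem/(sub_Lfun_finLfun Lh).
have mnf := cmeasurable_normc mf.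
apply/asboolP; split => //.
rewrite inE/=; apply/andP; split; rewrite inE//=.
apply: le_lt_trans fh; apply: le_Lnorm_EFin => // x.
by rewrite !ger0_norm ?normc_ge0// (le_trans (normc_ge0 _) (fleh x)).
Qed.

Lemma CLfun_submod_closed : submod_closed CLfun_pred.
Proof.
have p1E : (1 <= p%:E)%E by rewrite lee_fin.
split.
  apply: (@CLfun_dominated _ (fun=> 0)); first exact: cmeasurable0.
  - exact: (Lfun_addr_closed mu p1E).1.
  - by move=> x; rewrite ComplexField.Normc.normc0.
move=> a f g /asboolP[mf Lf] /asboolP[mg Lg].
apply: (@CLfun_dominated _
    ((normc a \o* (fun x => normc (f x))) \+ (fun x => normc (g x)))).
- exact/cmeasurableD/mg/cmeasurableZ.
- by apply: (Lfun_addr_closed mu p1E).2 => //; exact: Lfun_scale.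
- move=> x; rewrite (le_trans (le_normcD _ _))//.
  by rewrite -[(a *: f) x]/(a * f x) ComplexField.Normc.normcM /= mulrC.
Qed.


End CLfun.

(* CLfun_pred needs the proof p1 of 1 <= p only for its closure properties; it
   is a parameter here so that the instances can be found by unification. *)
Definition CLfun_ d (T : measurableType d) (R : realType)
    (mu : {measure set T -> \bar R}) (p : R) (p1 : 1 <= p) :
  {pred T -> R[i]} := CLfun_pred mu p.

HB.instance Definition _ d (T : measurableType d) (R : realType)
    (mu : {measure set T -> \bar R}) (p : R) (p1 : 1 <= p) :=
  GRing.isSubmodClosed.Build R[i] (T -> R[i]) (CLfun_ mu p1)
    (CLfun_submod_closed mu p1).

Record CLfunType d (T : measurableType d) (R : realType)
    (mu : {measure set T -> \bar R}) (p : R) (p1 : 1 <= p) := CLFun {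
  CLfun_val :> T -> R[i];
  CLfun_valP : CLfun_val \in CLfun_ mu p1 }.

Section CLfunType_lmod.
Context d (T : measurableType d) (R : realType).
Variables (mu : {measure set T -> \bar R}) (p : R) (p1 : 1 <= p).

HB.instance Definition _ := [isSub for @CLfun_val d T R mu p p1].
HB.instance Definition _ := [Choice of CLfunType mu p1 by <:].
HB.instance Definition _ := [SubChoice_isSubLmodule of CLfunType mu p1 by <:].

Definition ae_zero : {pred CLfunType mu p1} :=
  [pred f : CLfunType mu p1 | `[< \forall x \ae mu, f x = 0 >]].

Lemma ae_zero_zmod_closed : zmod_closed ae_zero.
Proof.
split; first by apply/asboolP; exact/nearW.
move=> f g /asboolP f0 /asboolP g0; apply/asboolP.
by apply: filterS2 f0 g0 => x fx gx; rewrite /= -[RHS](subrr 0) -{1}fx -gx.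
Qed.

HB.instance Definition _ :=
  GRing.isZmodClosed.Build (CLfunType mu p1) ae_zero ae_zero_zmod_closed.

End CLfunType_lmod.

(* The complex Lebesgue space: classes of p-integrable functions modulo
   equality almost everywhere. *)
Definition CLp d (T : measurableType d) (R : realType)
    (mu : {measure set T -> \bar R}) (p : R) (p1 : 1 <= p) : Type :=
  {ideal_quot (ae_zero (mu := mu) (p1 := p1))}.

Section CLp.
Context d (T : measurableType d) (R : realType).
Variables (mu : {measure set T -> \bar R}) (p : R) (p1 : 1 <= p).
Local Notation L := (CLp mu p1).
Local Notation C := R[i].
Local Open Scope quotient_scope.

HB.instance Definition _ := GRing.Zmodule.on L.
HB.instance Definition _ := EqQuotient.on L.

Definition CLp_class (f : CLfunType mu p1) : L := \pi_L f.

Lemma CLp_classP (f g : CLfunType mu p1) :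
  CLp_class f = CLp_class g <-> \forall x \ae mu, f x = g x.
Proof.
split.
- move=> /eqP; rewrite -Quotient.idealrBE => /asboolP.
  by apply: filterS => x /eqP; rewrite subr_eq0 => /eqP.
- move=> fg; apply/eqP; rewrite -Quotient.idealrBE; apply/asboolP.
  by apply: filterS fg => x fgx; rewrite -[LHS]/(f x - g x) fgx subrr.
Qed.

Lemma CLp_reprK : cancel (repr : L -> CLfunType mu p1) CLp_class.
Proof. exact: reprK. Qed.

Lemma CLp_classD f g : CLp_class (f + g) = CLp_class f + CLp_class g.
Proof. exact: (@Quotient.pi_add _ (ae_zero (p1:=p1))). Qed.

Lemma CLp_class0 : CLp_class 0 = 0.
Proof. by apply: (@addrI _ (CLp_class 0)); rewrite -CLp_classD !addr0. Qed.

Definition CLp_scale (a : C) (F : L) : L := CLp_class (a *: repr F).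

Lemma CLp_classZ a f : CLp_class (a *: f) = CLp_scale a (CLp_class f).
Proof.
apply/CLp_classP.
have /CLp_classP : CLp_class (repr (CLp_class f)) = CLp_class f.
  exact: CLp_reprK.
by apply: filterS => x fx; rewrite -[LHS]/(a * f x) -fx.
Qed.

Lemma CLp_scaleA (a b : C) F : CLp_scale a (CLp_scale b F) = CLp_scale (a * b) F.
Proof. by rewrite -[F]CLp_reprK -!CLp_classZ scalerA. Qed.

Lemma CLp_scale1 : left_id 1 CLp_scale.
Proof. by move=> F; rewrite -[F]CLp_reprK -CLp_classZ scale1r. Qed.

Lemma CLp_scaleDr : right_distributive CLp_scale +%R.
Proof.
move=> a F G; rewrite -[F]CLp_reprK -[G]CLp_reprK.
by rewrite -CLp_classD -!CLp_classZ -CLp_classD scalerDr.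
Qed.

Lemma CLp_scaleDl F : {morph CLp_scale^~ F : a b / a + b}.
Proof.
by move=> a b; rewrite -[F]CLp_reprK -!CLp_classZ -CLp_classD scalerDl.
Qed.

HB.instance Definition _ := GRing.Zmodule_isLmodule.Build C L
  CLp_scaleA CLp_scale1 CLp_scaleDr CLp_scaleDl.

Definition CLpnorm (F : L) : R :=
  fine 'N[mu]_p%:E[EFin \o (fun x => normc (repr F x))]%E.

Lemma CLp_measurable (f : CLfunType mu p1) :
  measurable_fun [set: T] (fun x => normc (f x)).
Proof. by have /asboolP[/cmeasurable_normc] := CLfun_valP f. Qed.

Lemma CLpnorm_class (f : CLfunType mu p1) :
  (CLpnorm (CLp_class f))%:E = 'N[mu]_p%:E[EFin \o (fun x => normc (f x))]%E.
Proof.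
have p0 : 0 < p by rewrite (lt_le_trans ltr01).
have fin (g : CLfunType mu p1) :
    'N[mu]_p%:E[EFin \o (fun x => normc (g x))]%E \is a fin_num.
  rewrite fin_numElt (lt_le_trans ltNy0) ?Lnorm_ge0//=.
  have /asboolP[_ gL] := CLfun_valP g.
  exact/set_mem/(sub_Lfun_finLfun gL).
rewrite /CLpnorm fineK//.
have mP (g : CLfunType mu p1) :
    measurable_fun [set: T] (fun x => `|(EFin \o (fun x => normc (g x))) x| `^ p)%E.
  apply: (@measurableT_comp _ _ _ _ _ _ (fun x => x `^ p)%E).
    exact: measurable_poweR.
  by apply: measurableT_comp => //; exact/measurable_EFinP/CLp_measurable.
rewrite unlock; congr (_ `^ _)%E; apply: ge0_ae_eq_integral => //.
- by move=> x _; exact: poweR_ge0.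
- by move=> x _; exact: poweR_ge0.
- have /CLp_classP : CLp_class (repr (CLp_class f)) = CLp_class f.
    exact: CLp_reprK.
  by apply: filterS => x fx _ /=; rewrite fx.
Qed.

Lemma ler_CLpnormD (F G : L) : CLpnorm (F + G) <= CLpnorm F + CLpnorm G.
Proof.
rewrite -[F]CLp_reprK -[G]CLp_reprK -CLp_classD -lee_fin EFinD !CLpnorm_class.
set f := repr F; set g := repr G.
have mf := CLp_measurable f; have mg := CLp_measurable g.
apply: (@le_trans _ _ ('N[mu]_p%:E[EFin \o
    ((fun x => normc (f x)) \+ (fun x => normc (g x)))%R])%E).
- apply: le_Lnorm_EFin => //; [exact: CLp_measurable|exact: measurable_funD|].
  move=> x; rewrite !ger0_norm ?addr_ge0 ?normc_ge0//.
  exact: le_normcD.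
- by apply: eminkowski => //; rewrite lee_fin.
Qed.

Lemma CLpnormZ (a : C) (F : L) : CLpnorm (a *: F) = normc a * CLpnorm F.
Proof.
rewrite -[F]CLp_reprK -[_ *: _]CLp_classZ.
apply: EFin_inj; rewrite EFinM !CLpnorm_class.
have p1E : (1 <= p%:E)%E by rewrite lee_fin.
have /asboolP[_ gL] := CLfun_valP (repr F).
rewrite -[RHS](_ : 'N[mu]_p%:E[EFin \o (normc a \*: Lfun_Sub p1E gL)] = _)%E.
  apply: eq_Lnorm => x /=.
  by congr EFin; exact: ComplexField.Normc.normcM.
by rewrite LnormZ/= ger0_norm ?normc_ge0.
Qed.

Lemma CLpnorm_eq0 (F : L) : CLpnorm F = 0 -> F = 0.
Proof.
have p0 : 0 < p by rewrite (lt_le_trans ltr01).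
rewrite -[F]CLp_reprK; set f := repr F => nf0.
have mf := CLp_measurable f.
have /Lnorm_eq0_eq0 f0 : 'N[mu]_p%:E[EFin \o (fun x => normc (f x))]%E = 0%E.
  by rewrite -CLpnorm_class nf0.
have /CLp_classP r0 : CLp_class (repr (0 : L)) = CLp_class 0.
  by rewrite CLp_reprK; rewrite CLp_class0.
rewrite -[0]CLp_reprK; apply/CLp_classP.
apply: filterS2 r0 (f0 _ _) => [x -> /(_ I)||].
- by case=> /ComplexField.Normc.eq0_normc.
- exact/measurable_EFinP.
- by rewrite lte_fin.
Qed.

(* normedModType C requires a C-valued norm. *)
Let normC (F : L) : C := (CLpnorm F)%:C%C.

Let ler_normCD F G : normC (F + G) <= normC F + normC G.
Proof. by rewrite /normC -rmorphD lecR ler_CLpnormD. Qed.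

Let normCZ a F : normC (a *: F) = `|a| * normC F.
Proof. by case: a => a b; rewrite /normC CLpnormZ rmorphM. Qed.

Let normC_eq0 F : normC F = 0 -> F = 0.
Proof. by move=> /complexI/CLpnorm_eq0. Qed.

HB.instance Definition _ := Lmodule_isNormed.Build C L
  ler_normCD normCZ normC_eq0.

Lemma CLp_normE (F : L) : `|F| = (CLpnorm F)%:C%C.
Proof. by []. Qed.

End CLp.

Section dual.
Context d (T : measurableType d) (R : realType).
Variables (mu : {measure set T -> \bar R}) (p : R) (p1 : 1 <= p).
Local Notation L := (CLp mu p1).

Definition bounded_functional (phi : {scalar L}) : Prop :=
  exists M : R, forall F : L, normc (phi F) <= M * CLpnorm F.

(* The topological dual. *)
Record CLp_dual := CLpDual {
  CLp_dual_val :> {scalar L};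
  CLp_dual_bounded : bounded_functional CLp_dual_val }.

(* The set is bounded above because phi is bounded, so that this sup is the least
   upper bound. *)
Definition opnorm (phi : CLp_dual) : R :=
  sup [set normc (phi F) | F in [set F : L | CLpnorm F <= 1]].

Lemma ler_opnorm (phi : CLp_dual) (F : L) :
  normc (phi F) <= opnorm phi * CLpnorm F.
Proof.
have [M phiM] := CLp_dual_bounded phi.
have normcR (r : R) : 0 <= r -> normc r%:C%C = r.
  by move=> r0; rewrite /= expr0n/= addr0 sqrtr_sqr ger0_norm.
have nF0 : 0 <= CLpnorm F by rewrite -ler0c -CLp_normE.
have [F0|F0] := eqVneq (CLpnorm F) 0.
  by rewrite (le_trans (phiM F))// F0 !mulr0.
have Fgt0 : 0 < CLpnorm F by rewrite lt0r F0.
rewrite -ler_pdivrMr//.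
have iF0 : 0 <= (CLpnorm F)^-1 by rewrite invr_ge0.
have -> : normc (phi F) / CLpnorm F = normc (phi ((CLpnorm F)^-1%:C%C *: F)).
  by rewrite linearZ ComplexField.Normc.normcM normcR// mulrC.
apply: ub_le_sup; last first.
  by exists ((CLpnorm F)^-1%:C%C *: F); rewrite //= CLpnormZ normcR// mulVf.
exists `|M| => _ [G /= G1 <-]; rewrite (le_trans (phiM G))//.
have nG0 : 0 <= CLpnorm G by rewrite -ler0c -CLp_normE.
rewrite (le_trans (ler_wpM2r nG0 (ler_norm M)))//.
by rewrite ler_piMr.
Qed.

End dual.

Section uncertainty.
Context d (T : measurableType d) (R : realType).
Variables (mu : {measure set T -> \bar R}) (p : R) (p1 : 1 <= p).
Local Notation L := (CLp mu p1).

Definition uncertainty (M : set L) (A : M -> L) (f : M) (a : R[i]) : R :=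
  CLpnorm (A f - a *: \val f).

Variables M N : set L.

Definition interl (f : M `&` N) : M :=
  SigSub (mem_set (set_mem (valP f)).1).
Definition interr (f : M `&` N) : N :=
  SigSub (mem_set (set_mem (valP f)).2).

Definition partial_add (A : M -> L) (B : N -> L) (f : M `&` N) : L :=
  A (interl f) + B (interr f).
Definition partial_sub (A : M -> L) (B : N -> L) (f : M `&` N) : L :=
  A (interl f) - B (interr f).

End uncertainty.

Definition conjugate_index (R : realType) (p q : R) : Prop :=
  1 < q /\ p^-1 + q^-1 = 1.

(* Main.v *)
Require Import Defs.
From HB Require Import structures.
From mathcomp Require Import all_boot all_order all_algebra.
From mathcomp Require Import ring_quotient complex.
From mathcomp Require Import all_classical all_reals all_analysis.
From mathcomp Require Import ring lra.
Import Order.TTheory GRing.Theory Num.Theory.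
Import numFieldNormedType.Exports.
Local Open Scope classical_set_scope.
Local Open Scope ring_scope.

(* Since phi vanishes at f and has norm at most 1, |phi(Af)| = |phi(Af - af)| is
   at most the uncertainty of A at f, and likewise for B. Each part thus follows
   from a Clarkson inequality for the two complex numbers phi(Af) and phi(Bf);
   no Clarkson inequality in L^p is needed.
   The basic one is |x+y|^p + |x-y|^p <= 2 (|x|^q + |y|^q)^(p-1) for p >= 2.
   The squares of |x+y| and |x-y| have the same sum as those of |x|+|y| and
   ||x|-|y||, which are farther apart, so convexity of u^(p/2) reduces it to
   x >= y >= 0, and by homogeneity to (x, y) = (1, t). There
     F(z) = (1 + z^(1-p) t) (1 + z t)^(p-1) + (1 - z^(1-p) t) (1 - z t)^(p-1)
   is nonincreasing on (0, 1], and its values at z = 1 and z = t^(q-1) are the two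
   sides. The other Clarkson inequalities follow by convexity of powers. *)

(** * Conjugate indices and the Clarkson inequality for nonnegative reals *)

Lemma clarkson_homotopy_is_derive (R : realType) (p t x : R) :
  0 < x -> 0 < t < 1 -> x <= 1 ->
  is_derive x 1 (fun x => (1 + x `^ (1 - p) * t) * (1 + x * t) `^ (p - 1)
                        + (1 - x `^ (1 - p) * t) * (1 - x * t) `^ (p - 1))
    ((p - 1) * t * (1 - x `^ (- p)) *
      ((1 + x * t) `^ (p - 2) - (1 - x * t) `^ (p - 2))).
Proof.
move=> x0 /andP[t0 t1] x1.
have u0 : 0 < 1 + x * t by nra.
have v0 : 0 < 1 - x * t by nra.
have du : is_derive x 1 (fun x => 1 + x * t) t.
  by apply: is_derive_eq; rewrite /GRing.scale/=; ring.
have dv : is_derive x 1 (fun x => 1 - x * t) (- t).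
  by apply: is_derive_eq; rewrite /GRing.scale/=; ring.
have dU := @is_derive1_comp _ (fun y => y `^ (p - 1)) (fun x => 1 + x * t)
  _ _ _ (is_derive1_powR _ u0) du.
have dV := @is_derive1_comp _ (fun y => y `^ (p - 1)) (fun x => 1 - x * t)
  _ _ _ (is_derive1_powR _ v0) dv.
have dX := is_derive1_powR (1 - p) x0.
apply: is_derive_eq.
rewrite /GRing.scale/=.
have -> : 1 - p - 1 = - p by ring.
have -> : p - 1 - 1 = p - 2 by ring.
have -> : x `^ (1 - p) = x * x `^ (- p).
  by rewrite powRD ?(gt_eqF x0) ?implybT// powRr1// ltW.
(* Once a factor [1 + x * t] or [1 - x * t] is split off, the terms in x^(1-p) cancel and 1 - x^(-p)
   comes out of both summands; in this form the sign of the derivative can be read off. *)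
have split1 y : 0 < y -> y `^ (p - 1) = y * y `^ (p - 2).
  move=> y0; have -> : p - 1 = 1 + (p - 2) by ring.
  by rewrite (@powRD _ y 1) ?(gt_eqF y0) ?implybT// powRr1// ltW.
rewrite !split1//; ring.
Qed.

Lemma conjugate_indexE (R : realType) (p q : R) :
  1 < p -> conjugate_index p q -> (q - 1) * (p - 1) = 1 /\ q * (p - 1) = p.
Proof.
move=> p1 [q1 pq].
have /eqP : p + q = p * q.
  have : (p^-1 + q^-1) * (p * q) = p * q by rewrite pq mul1r.
  by move=> <-; field; rewrite !gt_eqF// (lt_trans ltr01).
move=> /eqP h; split; lra.
Qed.

Lemma conjugate_index_exists (R : realType) (p : R) :
  1 < p -> conjugate_index p (p / (p - 1)).
Proof.
move=> p1; have p0 : 0 < p - 1 by rewrite subr_gt0.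
split; first by rewrite ltr_pdivlMr//; lra.
by field; rewrite !gt_eqF// (lt_trans ltr01).
Qed.

(** The mean value theorem on [t^(q-1), 1] compares the two values of F. The cases t = 0 and t = 1
    come first: there the left endpoint would be 0, or the interval a single point. *)
Lemma clarkson_unit (R : realType) (p q t : R) :
  2 <= p -> conjugate_index p q -> 0 <= t <= 1 ->
  (1 + t) `^ p + (1 - t) `^ p <= 2 * (1 + t `^ q) `^ (p - 1).
Proof.
move=> p2 pq /andP[]; have p1 : 1 < p by lra.
have p0 : 0 < p by lra.
have [qp1 qp] := conjugate_indexE _ _ _ p1 pq.
have q1 := pq.1.
rewrite le_eqVlt => /predU1P[<- _|t0].
  by rewrite subr0 !addr0 powR0 ?gt_eqF ?(lt_trans ltr01)// addr0 !powR1; lra.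
rewrite le_eqVlt => /predU1P[->|t1].
  rewrite subrr powR0 ?gt_eqF// powR1 addr0.
  by rewrite (_ : 1 + 1 = 2)// mulr_powRB1.
pose f x := (1 + x `^ (1 - p) * t) * (1 + x * t) `^ (p - 1)
          + (1 - x `^ (1 - p) * t) * (1 - x * t) `^ (p - 1).
pose df x := (p - 1) * t * (1 - x `^ (- p)) *
  ((1 + x * t) `^ (p - 2) - (1 - x * t) `^ (p - 2)).
(* As (q-1)(p-1) = 1, this is the point where z^(1-p) t = 1: the second summand of [f] vanishes and
   the first becomes 2 (1 + t^q)^(p-1). *)
pose a := t `^ (q - 1).
have a0 : 0 < a by exact: powR_gt0.
have a1 : a <= 1.
  by rewrite /a -[leRHS](powRr0 t); apply: ger_powR; [rewrite t0 ltW|lra].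
have fdf x : x \in `[a, 1] -> is_derive x 1 f (df x).
  rewrite in_itv/= => /andP[ax x1].
  by apply: clarkson_homotopy_is_derive; rewrite ?t0// (lt_le_trans a0).
have dfoo x : x \in `]a, 1[ -> is_derive x 1 f (df x).
  by move=> /subset_itv_oo_cc; exact: fdf.
have cf : {within `[a, 1], continuous f}.
  apply: derivable_within_continuous => x xa.
  by have := fdf x xa => ?; exact: ex_derive.
have [c] := MVT_segment a1 dfoo cf.
rewrite in_itv/= => /andP[ac c1] fE.
have c0 : 0 < c by exact: lt_le_trans ac.
have df_le0 : df c <= 0.
  (* Here c <= 1 gives c^(-p) >= 1, and p >= 2 makes u^(p-2) nondecreasing. *)
  rewrite /df; apply: mulr_le0_ge0.
    apply: mulr_ge0_le0; first by apply: mulr_ge0; lra.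
    rewrite subr_le0 -(powRr0 c); apply: ger_powR; first by rewrite c0.
    by lra.
  have ct0 : 0 <= c * t by rewrite mulr_ge0 ?ltW.
  have ct1 : c * t <= 1 by apply: mulr_ile1; rewrite ?c1 // ltW.
  rewrite subr_ge0; apply: ge0_ler_powR; rewrite ?nnegrE; lra.
have : f 1 <= f a.
  by rewrite -subr_le0 fE mulr_le0_ge0// subr_ge0.
have -> : f 1 = (1 + t) `^ p + (1 - t) `^ p.
  rewrite /f powR1 !mul1r !mulr_powRB1//; lra.
suff -> : f a = 2 * (1 + t `^ q) `^ (p - 1) by [].
have aE : a `^ (1 - p) * t = 1.
  rewrite /a -powRrM -(opprB p 1) mulrN qp1 powR_inv1 ?ltW// mulVf//.
  by rewrite gt_eqF.
have atE : a * t = t `^ q by rewrite /a mulrC mulr_powRB1 ?ltW// (lt_trans ltr01).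
by rewrite /f aE atE subrr mul0r addr0.
Qed.

(** Both sides are homogeneous of degree p because q (p-1) = p, so for x > 0 the ratio t = y/x
    reduces this to [clarkson_unit]. *)
Lemma clarkson_ge0 (R : realType) (p q x y : R) :
  2 <= p -> conjugate_index p q -> 0 <= y <= x ->
  (x + y) `^ p + (x - y) `^ p <= 2 * (x `^ q + y `^ q) `^ (p - 1).
Proof.
move=> p2 pq /andP[y0 yx]; have p1 : 1 < p by lra.
have [qp1 qp] := conjugate_indexE _ _ _ p1 pq.
have q1 := pq.1.
have : 0 <= x by exact: le_trans yx.
rewrite le_eqVlt => /predU1P[x0|x0].
  have -> : y = 0 by lra.
  rewrite -x0 subr0 addr0 !powR0 ?gt_eqF ?addr0 ?mulr_ge0 ?powR_ge0//; lra.
have t01 : 0 <= y / x <= 1.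
  by rewrite divr_ge0 ?(ltW x0)//= ler_pdivrMr// mul1r.
have := clarkson_unit _ _ _ _ p2 pq t01.
move: t01 => /andP[t0 t1].
have yE : y = x * (y / x) by field; rewrite gt_eqF.
move: (y / x) yE t0 t1 => t -> t0 t1 h.
have -> : x + x * t = x * (1 + t) by ring.
have -> : x - x * t = x * (1 - t) by ring.
rewrite !(powRM _ (ltW x0)) ?subr_ge0 ?addr_ge0//.
have -> : x `^ q + x `^ q * t `^ q = x `^ q * (1 + t `^ q) by ring.
rewrite powRM ?addr_ge0 ?powR_ge0// -powRrM qp.
rewrite -mulrDr mulrCA ler_wpM2l ?powR_ge0//.
Qed.

(** * Convexity of powers *)

Lemma powR_convex (R : realType) (k l x y : R) :
  1 <= k -> 0 <= l <= 1 -> 0 <= x -> 0 <= y ->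
  (l * x + (1 - l) * y) `^ k <= l * x `^ k + (1 - l) * y `^ k.
Proof.
move=> k1 /andP[l0 l1] x0 y0.
by apply: (convex_powR k1 (Itv01 l0 l1)); rewrite inE/= in_itv/= andbT.
Qed.

Lemma powR_mean (R : realType) (k x y : R) : 1 <= k -> 0 <= x -> 0 <= y ->
  (2^-1 * (x + y)) `^ k <= 2^-1 * (x `^ k + y `^ k).
Proof.
move=> k1 x0 y0; have := @powR_convex R k 2^-1 x y k1 _ x0 y0.
have -> : 1 - 2^-1 = 2^-1 :> R by field.
by rewrite -!mulrDr; apply; rewrite invr_ge0 invf_le1// ler0n ler1n.
Qed.

(** The numbers u and v are convex combinations of x and y with exchanged weights [l] and [1 - l];
    adding the two convexity inequalities removes the weights. *)
Lemma powR_majorization (R : realType) (k u v x y : R) : 1 <= k ->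
  0 <= y <= u -> u <= x -> u + v = x + y ->
  u `^ k + v `^ k <= x `^ k + y `^ k.
Proof.
move=> k1 /andP[y0 yu] ux uv.
(* If x <= y, the hypotheses force all four numbers to coincide, and [l] would have denominator
   0. *)
have [yx|xy] := ltP y x; last first.
  have -> : u = y by lra.
  have -> : v = x by lra.
  by rewrite addrC.
pose l := (u - y) / (x - y).
have xy0 : 0 < x - y by lra.
have l01 : 0 <= l <= 1.
  by apply/andP; split; [apply: divr_ge0|rewrite ler_pdivrMr// mul1r]; lra.
have l01' : 0 <= 1 - l <= 1 by move: l01 => /andP[]; lra.
have x0 : 0 <= x by lra.
have h1 := @powR_convex R k l x y k1 l01 x0 y0.
have h2 := @powR_convex R k (1 - l) x y k1 l01' x0 y0.
have uE : l * x + (1 - l) * y = u by rewrite /l; field; rewrite gt_eqF.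
have vE : (1 - l) * x + (1 - (1 - l)) * y = v by lra.
rewrite uE in h1; rewrite vE in h2; lra.
Qed.

(** * Clarkson inequalities for two complex numbers *)

Lemma normc_sqr (R : realType) (a b : R) : normc (a +i* b)%C ^+ 2 = a ^+ 2 + b ^+ 2.
Proof. by rewrite sqr_sqrtr// addr_ge0 ?sqr_ge0. Qed.

Lemma normc_parallelogram (R : realType) (x y : R[i]) :
  normc (x + y) ^+ 2 + normc (x - y) ^+ 2 = 2 * (normc x ^+ 2 + normc y ^+ 2).
Proof.
case: x y => [a b] [c e].
rewrite -[(a +i* b)%C + _]/((a + c) +i* (b + e))%C.
rewrite -[(a +i* b)%C - _]/((a - c) +i* (b - e))%C.
rewrite !normc_sqr; ring.
Qed.

Lemma clarkson_normc (R : realType) (p q : R) (x y : R[i]) :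
  2 <= p -> conjugate_index p q ->
  normc (x + y) `^ p + normc (x - y) `^ p
    <= 2 * (normc x `^ q + normc y `^ q) `^ (p - 1).
Proof.
move=> p2 pq.
wlog yx : x y / normc y <= normc x => [hw|].
  have [/hw//|/ltW/hw h] := leP (normc y) (normc x).
  rewrite [x + y]addrC -(opprB y x) normcN.
  by rewrite [normc x `^ q + _]addrC.
have nx := normc_ge0 x; have ny := normc_ge0 y.
apply: le_trans (@clarkson_ge0 R p q _ _ p2 pq _); last by rewrite ny.
(* Passing to squares lets the parallelogram identity supply the equal sums that majorization
   requires; the exponent p/2 is at least 1. *)
have sq (z : R) : 0 <= z -> z `^ p = (z ^+ 2) `^ (p / 2).
  by move=> z0; rewrite -powR_mulrn// -powRrM; congr (_ `^ _); field.
have k1 : 1 <= p / 2 by lra.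
have nS := normc_ge0 (x + y); have nD := normc_ge0 (x - y).
rewrite !sq ?subr_ge0 ?addr_ge0//.
apply: powR_majorization => //.
(* Reverse triangle inequality, from x = (x + y) - y. *)
- rewrite sqr_ge0/= ler_sqr ?nnegrE ?subr_ge0//.
  have := le_normcD (x + y) (- y); rewrite addrK normcN; lra.
- by rewrite ler_sqr ?nnegrE ?addr_ge0// le_normcD.
- rewrite normc_parallelogram; ring.
Qed.

Lemma ler_powRD (R : realType) (k x y x' y' : R) : 0 <= k ->
  0 <= x <= x' -> 0 <= y <= y' -> x `^ k + y `^ k <= x' `^ k + y' `^ k.
Proof.
move=> k0 /andP[x0 xx] /andP[y0 yy].
by apply: lerD; apply: ge0_ler_powR; rewrite ?nnegrE//; lra.
Qed.

(** The (p-1)-th root of [clarkson_normc]. Exchanging the two indices makes it serve an index at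
    most 2 as well. *)
Lemma clarkson_conj (R : realType) (p q : R) (x y : R[i]) :
  2 <= p -> conjugate_index p q ->
  (2^-1 * (normc (x + y) `^ p + normc (x - y) `^ p)) `^ (p - 1)^-1
    <= normc x `^ q + normc y `^ q.
Proof.
move=> p2 pq; have p1 : 0 < p - 1 by lra.
have N0 (z w : R[i]) k : 0 <= normc z `^ k + normc w `^ k by rewrite addr_ge0 ?powR_ge0.
have -> : normc x `^ q + normc y `^ q
    = ((normc x `^ q + normc y `^ q) `^ (p - 1)) `^ (p - 1)^-1.
  by rewrite -powRrM mulfV ?gt_eqF// powRr1.
apply: ge0_ler_powR; rewrite ?nnegrE ?powR_ge0//.
- by rewrite invr_ge0 ltW.
- by rewrite mulr_ge0 ?invr_ge0.
by rewrite ler_pdivrMl//; exact: clarkson_normc.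
Qed.

(** Convexity of u^(p-1) bounds the right side of [clarkson_normc]: the mean of |x|^q and |y|^q to
    the power p-1 is at most the mean of |x|^p and |y|^p. *)
Lemma clarkson_ge2 (R : realType) (p : R) (x y : R[i]) : 2 <= p ->
  (2 `^ (p - 1))^-1 * (normc (x + y) `^ p + normc (x - y) `^ p)
    <= normc x `^ p + normc y `^ p.
Proof.
move=> p2; have p1 : 1 < p by lra.
have pq := conjugate_index_exists _ _ p1; set q := p / (p - 1) in pq.
have [qp1 qp] := conjugate_indexE _ _ _ p1 pq.
rewrite ler_pdivrMl ?powR_gt0//.
apply: le_trans (@clarkson_normc _ _ _ x y p2 pq) _.
have k1 : 1 <= p - 1 by lra.
have := @powR_mean R (p - 1) (normc x `^ q) (normc y `^ q) k1 (powR_ge0 _ _) (powR_ge0 _ _).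
rewrite powRM ?invr_ge0 ?addr_ge0 ?powR_ge0// -!powRrM qp.
rewrite -powR_inv1// powRAC powR_inv1 ?powR_ge0// ler_pdivrMl ?powR_gt0//.
rewrite powR_inv1// => h.
by rewrite -ler_pdivlMl// mulrCA.
Qed.

Lemma clarkson_le2 (R : realType) (p : R) (x y : R[i]) : 1 < p <= 2 ->
  2^-1 * (normc (x + y) `^ p + normc (x - y) `^ p)
    <= normc x `^ p + normc y `^ p.
Proof.
move=> /andP[p1 p2].
have pq := conjugate_index_exists _ _ p1; set q := p / (p - 1) in pq.
have q1 := pq.1.
have qp : conjugate_index q p by split => //; rewrite addrC pq.2.
have [qp1 qpE] := conjugate_indexE _ _ _ p1 pq.
have [_ pqE] := conjugate_indexE _ _ _ q1 qp.
have q2 : 2 <= q by nra.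
have k1 : 1 <= q - 1 by lra.
have N0 (z w : R[i]) k : 0 <= normc z `^ k + normc w `^ k by rewrite addr_ge0 ?powR_ge0.
have k0 : 0 < q - 1 by lra.
(* It suffices to compare (q-1)-th powers. Convexity bounds that of the left side by a mean of q-th
   powers, since p (q-1) = q, and [clarkson_normc] with the indices exchanged bounds this mean. *)
rewrite leNgt; apply/negP => h.
have := gt0_ltr_powR k0 _ _ h; rewrite !nnegrE => /(_ (N0 _ _ _)).
rewrite mulr_ge0 ?invr_ge0// => /(_ isT); apply/negP; rewrite -leNgt.
apply: (le_trans (powR_mean _ _ _ _ k1 (powR_ge0 _ _) (powR_ge0 _ _))).
by rewrite -!powRrM pqE ler_pdivrMl//; exact: clarkson_normc.
Qed.

(** * Position of conjugate indices relative to 2, and the uncertainty inequalities *)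

Lemma conjugate_indexC (R : realType) (p q : R) :
  1 < p -> conjugate_index p q -> conjugate_index q p.
Proof. by move=> p1 [q1 pq]; split; rewrite // addrC. Qed.

Lemma conjugate_index_ge2 (R : realType) (p q : R) :
  1 < p <= 2 -> conjugate_index p q -> 2 <= q.
Proof.
move=> /andP[p1 p2] pq; have [qp _] := conjugate_indexE _ _ _ p1 pq.
have := pq.1; nra.
Qed.

Lemma conjugate_index_min_le2 (R : realType) (p q : R) :
  1 < p -> conjugate_index p q -> Num.min p q <= 2.
Proof.
move=> p1 pq; rewrite ge_min; have [//|/ltW p2/=] := leP p 2.
have [qp _] := conjugate_indexE _ _ _ p1 pq; have := pq.1; nra.
Qed.

Lemma normc_annihilator_le_uncertainty (R : realType) (d : measure_display)
    (Omega : measurableType d) (mu : {measure set Omega -> \bar R})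
    (p : R) (p1 : 1 <= p) (M : set (CLp mu p1)) (A : M -> CLp mu p1) (f : M)
    (a : R[i]) (phi : CLp_dual mu p1) :
  opnorm phi <= 1 -> phi (\val f) = 0 ->
  normc (phi (A f)) <= uncertainty A f a.
Proof.
move=> phi1 phif; rewrite /uncertainty.
have -> : phi (A f) = phi (A f - a *: \val f).
  by rewrite linearB linearZ/= phif mulr0 subr0.
apply: le_trans (ler_opnorm _ _) _; rewrite ler_piMl//.
by rewrite -ler0c -CLp_normE.
Qed.

Theorem theorem2p2 (R : realType) (d : measure_display) (Omega : measurableType d)
    (mu : {measure set Omega -> \bar R}) (p : R) (p_gt1 : 1 < p)
    (M N : set (CLp mu (ltW p_gt1)))
    (A : M -> CLp mu (ltW p_gt1)) (B : N -> CLp mu (ltW p_gt1))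
    (f : M `&` N) (a b : R[i]) (phi : CLp_dual mu (ltW p_gt1))
    (phi_le1 : opnorm phi <= 1) (phif0 : phi (\val f) = 0) :
  let DA := uncertainty A (interl f) a in
  let DB := uncertainty B (interr f) b in
  let phiS := normc (phi (partial_add A B f)) in
  let phiD := normc (phi (partial_sub A B f)) in
  (2 <= p ->
    DA `^ p + DB `^ p >= (2 `^ (p - 1))^-1 * (phiS `^ p + phiD `^ p)) /\
  (p <= 2 ->
    DA `^ p + DB `^ p >= 2^-1 * (phiS `^ p + phiD `^ p)) /\
  (forall q : R, 2 <= p -> conjugate_index p q ->
    DA `^ q + DB `^ q >= (2^-1 * (phiS `^ p + phiD `^ p)) `^ (p - 1)^-1) /\
  (forall q : R, p <= 2 -> conjugate_index p q ->
    DA `^ p + DB `^ p >= (2^-1 * (phiS `^ q + phiD `^ q)) `^ (q - 1)^-1) /\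
  (forall q r s : R, conjugate_index p q -> 1 < r -> r <= Num.min p q ->
    conjugate_index r s ->
    [/\ DA `^ r + DB `^ r >= (2^-1 * (phiS `^ s + phiD `^ s)) `^ (s - 1)^-1,
        DA `^ s + DB `^ s >= (2 `^ (s - 1))^-1 * (phiS `^ s + phiD `^ s) &
        DA `^ r + DB `^ r >= 2^-1 * (phiS `^ r + phiD `^ r)]).
Proof.
move=> DA DB phiS phiD.
pose u := phi (A (interl f)); pose v := phi (B (interr f)).
have uDA : 0 <= normc u <= DA.
  by rewrite normc_ge0; exact: normc_annihilator_le_uncertainty.
have vDB : 0 <= normc v <= DB.
  by rewrite normc_ge0; exact: normc_annihilator_le_uncertainty.
have SE : phiS = normc (u + v) by rewrite /phiS /partial_add linearD.
have DE : phiD = normc (u - v) by rewrite /phiD /partial_sub linearB.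
rewrite SE DE.
(* This passes from the two complex numbers to the uncertainties; only Clarkson inequalities for [u]
   and [v] remain. *)
have mono k : 1 < k -> normc u `^ k + normc v `^ k <= DA `^ k + DB `^ k.
  by move=> k1; apply: ler_powRD => //; lra.
split; [|split; [|split; [|split]]].
- by move=> p2; apply: le_trans (clarkson_ge2 _ _ _ _ p2) (mono _ p_gt1).
- move=> p2; apply: le_trans (clarkson_le2 _ _ _ _ _) (mono _ p_gt1).
  by rewrite p_gt1.
- by move=> q p2 pq; apply: le_trans (clarkson_conj _ _ _ _ _ p2 pq) (mono _ pq.1).
- move=> q p2 pq; apply: le_trans (clarkson_conj _ _ _ _ _ _ _) (mono _ p_gt1).
    by apply: conjugate_index_ge2 pq; rewrite p_gt1.
  exact: conjugate_indexC.
- move=> q r s pq r1 rpq rs.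
  (* One of two conjugate indices is at most 2, hence so is r, and s >= 2: the pair (s, r) can take
     the place of (p, q) in the Clarkson inequalities. *)
  have r2 : 1 < r <= 2.
    by rewrite r1 (le_trans rpq) ?conjugate_index_min_le2.
  have s2 := conjugate_index_ge2 _ _ _ r2 rs.
  split.
  + apply: le_trans (clarkson_conj _ _ _ _ _ s2 _) (mono _ r1).
    exact: conjugate_indexC.
  + exact: le_trans (clarkson_ge2 _ _ _ _ s2) (mono _ rs.1).
  + exact: le_trans (clarkson_le2 _ _ _ _ r2) (mono _ r1).
Qed.
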